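(* Let $p\ge1$, $q=2p$, and let $\mathbf{Z}=(\mathbf{Z}^{(a)},\mathbf{Z}^{(b)})$ and $\mathbf{W}=(\mathbf{W}^{(a)},\mathbf{W}^{(b)})$ be $q$-dimensional random vectors, each of whose blocks has $p$ components, in the max-domains of attraction of extreme value distributions with nested stable tail dependence functions $$L_{\mathbf{Z}}(\mathbf{x})=L^{(0)}_{\mathbf{Z}}\big(L^{(a)}_{\mathbf{Z}}(\mathbf{x}^{(a)}),L^{(b)}_{\mathbf{Z}}(\mathbf{x}^{(b)})\big),\qquad L_{\mathbf{W}}(\mathbf{x})=L^{(0)}_{\mathbf{W}}\big(L^{(a)}_{\mathbf{W}}(\mathbf{x}^{(a)}),L^{(b)}_{\mathbf{W}}(\mathbf{x}^{(b)})\big),$$ for $\mathbf{x}=(\mathbf{x}^{(a)},\mathbf{x}^{(b)})\in[0,\infty)^p\times[0,\infty)^p$. Suppose that $\mathbf{Z}$ and $\mathbf{W}$ have the same marginal extremal dependence structure, i.e. $L^{(a)}_{\mathbf{Z}}=L^{(a)}_{\mathbf{W}}$ and $L^{(b)}_{\mathbf{Z}}=L^{(b)}_{\mathbf{W}}$, and that $\mathbf{Z}$ is more concordant than $\mathbf{W}$ in the max-domain of attraction, i.e. $L^{(0)}_{\mathbf{Z}}(\mathbf{y})\le L^{(0)}_{\mathbf{W}}(\mathbf{y})$ for all $\mathbf{y}\in[0,\infty)^2$. Then $$\mathrm{SECO}(\mathbf{Z}^{(a)},\mathbf{Z}^{(b)})-\mathrm{SECO}(\mathbf{W}^{(a)},\mathbf{W}^{(b)})=L^{(0)}_{\mathbf{W}}\big(L^{(a)}_{\mathbf{W}}(\mathbf{1}),L^{(b)}_{\mathbf{W}}(\mathbf{1})\big)-L^{(0)}_{\mathbf{Z}}\big(L^{(a)}_{\mathbf{W}}(\mathbf{1}),L^{(b)}_{\mathbf{W}}(\mathbf{1})\big)\ge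 0 .$$
   Context: For a random vector $\mathbf{Z}$ with distribution function $F$, whose univariate margins are $F^{(j,\ell)}$, in the max-domain of attraction of an extreme value distribution, the stable tail dependence function is $L(\mathbf{x})=\lim_{t\downarrow0}t^{-1}\mathbb{P}\{\bigcup_{j,\ell}\{F^{(j,\ell)}(Z^{(j,\ell)})>1-t\,x^{(j,\ell)}\}\}$, for $\mathbf{x}$ with nonnegative entries. Here $L^{(0)}_{\mathbf{Z}},L^{(0)}_{\mathbf{W}}$ (the ''mother'' functions) are bivariate stable tail dependence functions on $[0,\infty)^2$, and $L^{(j)}_{\mathbf{Z}},L^{(j)}_{\mathbf{W}}$, $j\in\{a,b\}$, are the $p$-variate stable tail dependence functions of $\mathbf{Z}^{(j)},\mathbf{W}^{(j)}$. $\mathbf{1}$ is the vector of ones in $\mathbb{R}^p$. The Sum of Extremal COefficients is $\mathrm{SECO}(\mathbf{Z}^{(a)},\mathbf{Z}^{(b)})=\theta(a)+\theta(b)-\theta(a,b)$, where $\theta(j)=\lim_{t\downarrow0}t^{-1}\mathbb{P}\{\max_{\ell}F^{(j,\ell)}(Z^{(j,\ell)})>1-t\}$, $j \in\{a,b\}$, and $\theta(a,b)=\lim_{t\downarrow0}t^{-1}\mathbb{P}\{\max_{j\in\{a,b\}}\max_{\ell}F^{(j,\ell)}(Z^{(j,\ell)})>1-t\}$; similarly for $\mathbf{W}$. *)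

(* Defs.v *)
(* MathComp-Analysis, over an arbitrary R : realType. *)
From HB Require Import structures.
From mathcomp Require Import all_boot all_order all_algebra.
From mathcomp Require Import all_classical all_reals all_analysis.

Set Implicit Arguments.
Unset Strict Implicit.
Unset Printing Implicit Defensive.

Import Order.TTheory GRing.Theory Num.Theory.
Import numFieldNormedType.Exports.

Local Open Scope classical_set_scope.
Local Open Scope ring_scope.

(* An n-dimensional random vector is the family Z : 'I_n -> {RV P >-> R} of its
   components; points of R^n are row vectors. *)

Section RandomVector.
Context d (T : measurableType d) (R : realType) (P : probability T R).

Definition prob (A : set T) : R := fine (P A).

Definition joint_cdf n (Z : 'I_n -> {RV P >-> R}) (x : 'rV[R]_n) : R :=
  prob [set w | forall i, Z i w <= x 0 i].

(* The random variable F_X(X), for F_X the distribution function of X. *)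
Definition prob_transform (X : {RV P >-> R}) (w : T) : R := fine (cdf X (X w)).

Definition nondegenerate (X : {RV P >-> R}) : Prop :=
  forall c : R, prob [set w | X w = c] != 1.

End RandomVector.

(* Convergence in distribution of affinely normalized componentwise maxima of
   i.i.d. copies of Z to a law with nondegenerate margins, that of Y.  The
   extreme value distributions are by definition the laws of such limits. *)
Definition in_max_domain_of_attraction d (T : measurableType d) (R : realType)
    (P : probability T R) n (Z : 'I_n -> {RV P >-> R}) : Prop :=
  exists (d' : measure_display) (T' : measurableType d')
         (Q : probability T' R) (Y : 'I_n -> {RV Q >-> R})
         (a b : nat -> 'rV[R]_n),
    [/\ forall i, nondegenerate (Y i),
        forall k i, 0 < a k 0 i &
        forall x, {for x, continuous (joint_cdf Y)} ->
          (joint_cdf Z (\row_i (a k 0 i * x 0 i + b k 0 i))) ^+ k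
            @[k --> \oo] --> joint_cdf Y x].

Definition nonneg (R : realType) n (x : 'rV[R]_n) : Prop :=
  forall i, 0 <= x 0 i.

(* The limit exists, for every x with nonnegative entries, as soon as Z is in
   the max-domain of attraction of an extreme value distribution. *)
Definition stdf d (T : measurableType d) (R : realType) (P : probability T R)
    n (Z : 'I_n -> {RV P >-> R}) (x : 'rV[R]_n) : R :=
  lim (t^-1 * prob P (\bigcup_i [set w | prob_transform (Z i) w > 1 - t * x 0 i])
       @[t --> 0^'+]).

(* L, seen as a function on [0, oo[^2 only, is the stable tail dependence
   function of some bivariate random vector. *)
Definition bivariate_stdf (R : realType) (L : R -> R -> R) : Prop :=
  exists (d : measure_display) (T : measurableType d) (P : probability T R)
         (V : 'I_2 -> {RV P >-> R}),
    in_max_domain_of_attraction V /\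
    forall y : 'rV[R]_2, nonneg y -> L (y 0 0) (y 0 1) = stdf V y.

Section Seco.
Context d (T : measurableType d) (R : realType) (P : probability T R) (p : nat).
Implicit Type Z : 'I_(p + p) -> {RV P >-> R}.

Definition block_a Z : 'I_p -> {RV P >-> R} := fun l => Z (lshift p l).
Definition block_b Z : 'I_p -> {RV P >-> R} := fun l => Z (rshift p l).

(* Distribution functions are nonnegative, so for p > 0 the unit 0 does not
   affect the maximum. *)
Definition max_transform (X : 'I_p -> {RV P >-> R}) (w : T) : R :=
  \big[Num.max/0]_(l < p) prob_transform (X l) w.

Definition theta (X : 'I_p -> {RV P >-> R}) : R :=
  lim (t^-1 * prob P [set w | max_transform X w > 1 - t] @[t --> 0^'+]).

Definition theta_joint (X X' : 'I_p -> {RV P >-> R}) : R :=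
  lim (t^-1 * prob P [set w | Num.max (max_transform X w) (max_transform X' w)
                                > 1 - t] @[t --> 0^'+]).

Definition SECO (X X' : 'I_p -> {RV P >-> R}) : R :=
  theta X + theta X' - theta_joint X X'.

(* For x = (x_a, x_b), the blocks of x are lsubmx x and rsubmx x. *)
Definition nested_stdf Z (L0 : R -> R -> R) : Prop :=
  forall x : 'rV[R]_(p + p), nonneg x ->
    stdf Z x = L0 (stdf (block_a Z) (lsubmx x)) (stdf (block_b Z) (rsubmx x)).

End Seco.

(* Main.v *)
Require Import Defs.
From HB Require Import structures.
From mathcomp Require Import all_boot all_order all_algebra.
From mathcomp Require Import all_classical all_reals all_analysis.

(* The extremal coefficients are values of stable tail dependence functions at
   the vector of ones, because a maximum exceeds a level exactly when one of its
   entries does.  The block terms of the two SECOs then cancel, the nesting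
   turns the remaining joint terms into the mother functions at the common
   block extremal coefficients, and concordance gives the sign. *)

Set Implicit Arguments.
Unset Strict Implicit.
Unset Printing Implicit Defensive.

Import Order.TTheory GRing.Theory Num.Theory.
Import numFieldNormedType.Exports.

Local Open Scope classical_set_scope.
Local Open Scope ring_scope.

Section ExtremalCoefficients.
Context d (T : measurableType d) (R : realType) (P : probability T R).

Lemma prob_ge0 (A : set T) : 0 <= prob P A.
Proof. exact: fine_ge0. Qed.

Lemma prob_transform_ge0 (X : {RV P >-> R}) w : 0 <= prob_transform X w.
Proof. exact/fine_ge0/cdf_ge0. Qed.

(* When the limit does not exist, [lim] returns the default point 0 of R. *)
Lemma stdf_ge0 n (Z : 'I_n -> {RV P >-> R}) x : 0 <= stdf Z x.
Proof.
rewrite /stdf; set F := (X in lim X).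
have [cvF|/dvgP -> //] := pselect (cvg F).
apply: limr_ge => //; near=> t.
by rewrite mulr_ge0 ?prob_ge0// invr_ge0.
Unshelve. all: by end_near. Qed.

(** The level [r] may be negative, and then the unit 0 of the maximum already exceeds it; [0 < p]
    supplies a component to serve as witness. *)
Lemma max_transform_gtP p (X : 'I_p -> {RV P >-> R}) w r : (0 < p)%N ->
  r < max_transform X w <-> exists l, r < prob_transform (X l) w.
Proof.
move=> p_gt0; split=> [/bigmax_gtP[r_lt0|[l _ Xl]]|[l Xl]].
(* Case [r < 0]: any component works, since distribution functions are nonnegative. *)
- exists (Ordinal p_gt0); exact: lt_le_trans r_lt0 (prob_transform_ge0 _ _).
- by exists l.
- by apply/bigmax_gtP; right; exists l.
Qed.

Lemma max_transform_gt_bigcup p (X : 'I_p -> {RV P >-> R}) t : (0 < p)%N ->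
  [set w | max_transform X w > 1 - t] =
  \bigcup_i [set w | prob_transform (X i) w > 1 - t * (const_mx 1 : 'rV[R]_p) 0 i].
Proof.
move=> p_gt0; apply/seteqP; split=> [w /=|w [l _ /=]].
  by move=> /(max_transform_gtP X w _ p_gt0)[l Xl]; exists l; rewrite //= mxE mulr1.
by rewrite mxE mulr1 => Xl; apply/(max_transform_gtP X w _ p_gt0); exists l.
Qed.

Lemma max_block_transform_gt_bigcup p (Z : 'I_(p + p) -> {RV P >-> R}) t :
  (0 < p)%N ->
  [set w | Num.max (max_transform (block_a Z) w) (max_transform (block_b Z) w)
             > 1 - t] =
  \bigcup_i [set w | prob_transform (Z i) w
                       > 1 - t * (const_mx 1 : 'rV[R]_(p + p)) 0 i].
Proof.
move=> p_gt0; apply/seteqP; split=> [w /=|w [i _ /=]].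
  by rewrite lt_max => /orP[] /(max_transform_gtP _ w _ p_gt0)[l Zl];
    [exists (lshift p l)|exists (rshift p l)]; rewrite //= mxE mulr1.
(* Writing [i] as [unsplit] of its [split] makes [Z i] a component of [block_a] or of [block_b] in
   each case. *)
rewrite mxE mulr1 lt_max -(splitK i) /unsplit.
by case: (fintype.split i) => l Zl; apply/orP; [left|right];
  apply/(max_transform_gtP _ w _ p_gt0); exists l.
Qed.

(** The events coincide for every [t], so both sides are [lim] of the same function. *)
Lemma theta_stdf p (X : 'I_p -> {RV P >-> R}) : (0 < p)%N ->
  theta X = stdf X (const_mx 1).
Proof.
by move=> p_gt0; rewrite /theta; under eq_fun do rewrite max_transform_gt_bigcup//.
Qed.

Lemma theta_joint_stdf p (Z : 'I_(p + p) -> {RV P >-> R}) : (0 < p)%N ->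
  theta_joint (block_a Z) (block_b Z) = stdf Z (const_mx 1).
Proof.
move=> p_gt0; rewrite /theta_joint.
by under eq_fun do rewrite max_block_transform_gt_bigcup//.
Qed.

Lemma SECO_nested p (Z : 'I_(p + p) -> {RV P >-> R}) (L0 : R -> R -> R) :
  (0 < p)%N -> nested_stdf Z L0 ->
  SECO (block_a Z) (block_b Z) =
    stdf (block_a Z) (const_mx 1) + stdf (block_b Z) (const_mx 1)
    - L0 (stdf (block_a Z) (const_mx 1)) (stdf (block_b Z) (const_mx 1)).
Proof.
move=> p_gt0 nestedZ.
rewrite /SECO !theta_stdf// theta_joint_stdf// nestedZ => [|i].
  (* Both blocks of the vector of ones are again vectors of ones. *)
  by rewrite -row_mx_const row_mxKl row_mxKr.
by rewrite mxE ler01.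
Qed.

End ExtremalCoefficients.

Theorem mainTheorem2 (R : realType) (p : nat) (hp : (0 < p)%N)
    (dZ : measure_display) (TZ : measurableType dZ) (PZ : probability TZ R)
    (Z : 'I_(p + p) -> {RV PZ >-> R})
    (dW : measure_display) (TW : measurableType dW) (PW : probability TW R)
    (W : 'I_(p + p) -> {RV PW >-> R})
    (L0Z L0W : R -> R -> R)
    (mdaZ : in_max_domain_of_attraction Z)
    (mdaW : in_max_domain_of_attraction W)
    (stdfL0Z : bivariate_stdf L0Z)
    (stdfL0W : bivariate_stdf L0W)
    (nestedZ : nested_stdf Z L0Z)
    (nestedW : nested_stdf W L0W)
    (same_a : forall x : 'rV[R]_p, nonneg x ->
       stdf (block_a Z) x = stdf (block_a W) x)
    (same_b : forall x : 'rV[R]_p, nonneg x ->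
       stdf (block_b Z) x = stdf (block_b W) x)
    (concordant : forall u v : R, 0 <= u -> 0 <= v -> L0Z u v <= L0W u v) :
  let one : 'rV[R]_p := const_mx 1 in
  let gap := L0W (stdf (block_a W) one) (stdf (block_b W) one)
             - L0Z (stdf (block_a W) one) (stdf (block_b W) one) in
  SECO (block_a Z) (block_b Z) - SECO (block_a W) (block_b W) = gap
  /\ 0 <= gap.
Proof.
move=> one gap.
have one_ge0 : nonneg one by move=> i; rewrite mxE ler01.
(* Concordance is applied at the pair of block extremal coefficients of [W], which lies in the
   nonnegative quadrant. *)
split; last by rewrite subr_ge0; apply: concordant; exact: stdf_ge0.
(* The block coefficients of [Z] become those of [W] inside [L0Z] too, so both mother functions
   share their arguments. *)
rewrite (SECO_nested hp nestedZ) (SECO_nested hp nestedW) same_a// same_b//.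
by rewrite /gap opprB addrC subrKA.
Qed.
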